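(* Let $(\Omega,b,d)$ be a mixed complex of $R$-modules, let $k$ be the centre of $R$, let $(c_n)$ be a sequence of polynomials in $k[x]$, and put $\xi=bd+db$, $B_n:=c_nd_n$, $\upsilon_n:=b_{n+1}B_n+B_{n-1}b_n$. Then for all $n\ge 0$ $$\upsilon_n=\xi_nc_n-d_{n-1}b_nf_n=b_{n+1}d_nf_n+\xi_nc_{n-1},$$ where $f_n:=c_n-c_{n-1}$, and $$(\upsilon_n-\xi_nc_n)(\upsilon_n-\xi_nc_{n-1})=0.$$
   Context: $R$ is a unital associative ring with centre $k$. A mixed complex $(\Omega,b,d)$ of $R$-modules consists of $R$-modules $\Omega_n$ ($n\ge 0$; $\Omega_n=0$ for $n<0$) and $R$-linear maps $b_n:\Omega_n\to\Omega_{n-1}$, $d_n:\Omega_n\to\Omega_{n+1}$ with $b^2=0$, $d^2=0$ (so $b_0=0$, $d_{-1}=0$). Put $\xi_n=b_{n+1}d_n+d_{n-1}b_n:\Omega_n\to\Omega_n$; $\xi$ commutes with $b$ and $d$. $k[x]$ acts on $\Omega$ with $x$ acting as $\xi$; a polynomial $p\in k[x]$ written in a composition of operators stands for $p(\xi)$ (which commutes with $b$, $d$ and $\xi$). Thus $B_n=c_nd_n=c_n(\xi_{n+1})\circ d_n=d_n\circ c_n(\xi_n)$, and $B_{-1}=0$. For $n=0$, the polynomial $c_{-1}\in k[x]$ may be chosen arbitrarily. *)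

(* Defs.v *)
From HB Require Import structures.
From mathcomp Require Import all_boot all_order all_algebra.
From mathcomp Require Import boolp.

Set Implicit Arguments.
Unset Strict Implicit.
Unset Printing Implicit Defensive.

Import GRing.Theory.
Local Open Scope ring_scope.

Section Center.
Variable R : nzRingType.

Definition central : pred R := fun a => `[< forall r : R, a * r = r * a >].

Lemma centralP (a : R) : reflect (forall r, a * r = r * a) (a \in central).
Proof. exact: asboolP. Qed.

Fact central_subring : subring_closed central.
Proof.
split=> [|a b /centralP ha /centralP hb|a b /centralP ha /centralP hb];
  apply/centralP => r.
- by rewrite mul1r mulr1.
- by rewrite mulrBl mulrBr ha hb.
- by rewrite -mulrA hb mulrA ha mulrA.
Qed.

HB.instance Definition _ := GRing.isSubringClosed.Build R central central_subring.

Record center := Center { center_val :> R; _ : center_val \in central }.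

HB.instance Definition _ := [isSub for center_val].
HB.instance Definition _ := [Choice of center by <:].
HB.instance Definition _ := [SubChoice_isSubNzRing of center by <:].

Fact center_mulC : commutative (@GRing.mul center).
Proof.
by move=> a b; apply: val_inj; rewrite !rmorphM; apply/(centralP _ (valP a)).
Qed.

HB.instance Definition _ := GRing.PzRing_hasCommutativeMul.Build center center_mulC.

End Center.

(* The action of k[x] on M with x acting as f, k being the centre of R;
   centrality of the coefficients makes p(f) R-linear. *)
Section PolyEnd.
Variables (R : nzRingType) (M : lmodType R).
Variables (p : {poly center R}) (f : {linear M -> M}).

Definition poly_end (u : M) : M :=
  \sum_(i < size p) (p`_i : R) *: iter i f u.

Fact poly_end_is_linear : linear poly_end.
Proof.
move=> a u v; rewrite /poly_end scaler_sumr -big_split /=.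
apply: eq_bigr => i _.
have -> : iter i f (a *: u + v) = a *: iter i f u + iter i f v.
  by elim: (nat_of_ord i) => //= j ->; rewrite linearP.
by rewrite scalerDr !scalerA (centralP _ (valP p`_i)).
Qed.

HB.instance Definition _ :=
  GRing.isLinear.Build R M M *:%R poly_end poly_end_is_linear.

End PolyEnd.

(* [mc_b W n] is b_{n+1} : W_{n+1} -> W_n; since W_{-1} = 0, the map b_0
   carries no data.  [mc_d W n] is d_n. *)
Record mixed_complex (R : nzRingType) := MixedComplex {
  mc_mod :> nat -> lmodType R;
  mc_b : forall n, {linear mc_mod n.+1 -> mc_mod n};
  mc_d : forall n, {linear mc_mod n -> mc_mod n.+1};
  mc_bb : forall n u, mc_b n (mc_b n.+1 u) = 0;
  mc_dd : forall n u, mc_d n.+1 (mc_d n u) = 0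
}.

Section MixedComplexOps.
Variables (R : nzRingType) (W : mixed_complex R).

(* The composite D_{n-1} b_n, which is 0 for n = 0. *)
Definition lower (D : forall n, {linear W n -> W n.+1}) (n : nat) :
    {linear W n -> W n} :=
  match n return {linear W n -> W n} with
  | 0 => \0
  | m.+1 => D m \o mc_b W m
  end.

Definition xi (n : nat) : {linear W n -> W n} :=
  (mc_b W n \o mc_d W n) \+ lower (mc_d W) n.

Section Sequence.
Variable c : nat -> {poly center R}.

Definition mcB (n : nat) : {linear W n -> W n.+1} :=
  poly_end (c n) (xi n.+1) \o mc_d W n.

Definition upsilon (n : nat) : {linear W n -> W n} :=
  (mc_b W n \o mcB n) \+ lower mcB n.

End Sequence.
End MixedComplexOps.

(* c_{n-1}, with [c'] in the role of c_{-1}. *)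
Definition pred_seq (T : Type) (c' : T) (c : nat -> T) (n : nat) : T :=
  if n is m.+1 then c m else c'.

(* Main.v *)
Require Import Defs.
From mathcomp Require Import all_boot all_order all_algebra.

(** Write e for the composite d b in degree n, so that xi = b d + e.  Since d
    and b intertwine the operators xi of neighbouring degrees ([mc_d_xi],
    [mc_b_xi]), they can be moved across any polynomial in xi
    ([poly_end_intertwine]), and
      upsilon = b d c_n(xi) + e c_{n-1}(xi)
    ([upsilonE]).  Replacing b d by xi - e, or e by xi - b d, gives the two
    formulas for upsilon.  They say that upsilon - xi c_n = - e f_n and
    upsilon - xi c_{n-1} = b d f_n, so the product of these two operators is
    - e b d f_n^2, which vanishes because e b = d b b = 0.  In degree 0 the
    operator e is zero, which is why c_{-1} may be arbitrary. *)

Set Implicit Arguments.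
Unset Strict Implicit.
Unset Printing Implicit Defensive.

Import GRing.Theory.
Local Open Scope ring_scope.

Section PolyEndTheory.
Variable R : nzRingType.

(** A common range of summation is what makes polynomials of different sizes
    comparable. *)
Lemma poly_end_wide (M : lmodType R) (p : {poly center R})
    (f : {linear M -> M}) m u :
  (size p <= m)%N -> poly_end p f u = \sum_(i < m) (p`_i : R) *: iter i f u.
Proof.
move=> le_pm; rewrite /poly_end.
rewrite (big_ord_widen m (fun i => (p`_i : R) *: iter i f u)) //.
rewrite big_mkcond /=; apply: eq_bigr => i _.
case: ltnP => // le_pi; rewrite nth_default //.
by rewrite (_ : center_val 0 = 0) ?scale0r.
Qed.

Lemma poly_endB (M : lmodType R) (p q : {poly center R})
    (f : {linear M -> M}) u :
  poly_end (p - q) f u = poly_end p f u - poly_end q f u.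
Proof.
set m := maxn (size p) (size q).
have le_pq : (size (p - q)%R <= m)%N.
  by rewrite (leq_trans (size_polyD _ _)) // size_polyN.
rewrite (poly_end_wide _ _ le_pq) !(@poly_end_wide _ _ _ m).
- rewrite -sumrB; apply: eq_bigr => i _.
  by rewrite coefB -scalerBl; congr (_ *: _); exact: (rmorphB val).
- exact: leq_maxr.
- exact: leq_maxl.
Qed.

Lemma poly_end_intertwine (M N : lmodType R) (p : {poly center R})
    (f : {linear M -> M}) (f' : {linear N -> N}) (g : {linear M -> N}) u :
  (forall v, g (f v) = f' (g v)) -> g (poly_end p f u) = poly_end p f' (g u).
Proof.
move=> gf; rewrite /poly_end linear_sum; apply: eq_bigr => i _.
by rewrite linearZ /=; congr (_ *: _); elim: (nat_of_ord i) => //= j <-.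
Qed.

End PolyEndTheory.

Section MixedComplexTheory.
Variables (R : nzRingType) (W : mixed_complex R).

Local Notation b := (mc_b W).
Local Notation d := (mc_d W).
Local Notation e := (lower d).

Lemma lower_mc_b n u : e n (b n u) = 0.
Proof. by case: n u => [|n] u //=; rewrite mc_bb raddf0. Qed.

Lemma mc_d_lower n u : d n (e n u) = 0.
Proof. by case: n u => [|n] u /=; rewrite ?raddf0 ?mc_dd. Qed.

Lemma mc_d_xi n u : d n (xi W n u) = xi W n.+1 (d n u).
Proof. by rewrite /xi /= raddfD /= mc_d_lower mc_dd raddf0 addr0 add0r. Qed.

Lemma mc_b_xi n u : b n (xi W n.+1 u) = xi W n (b n u).
Proof. by rewrite /xi /= raddfD /= lower_mc_b mc_bb add0r addr0. Qed.

Lemma upsilonE (c : nat -> {poly center R}) (c' : {poly center R}) n u :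
  upsilon W c n u = b n (d n (poly_end (c n) (xi W n) u))
                    + e n (poly_end (pred_seq c' c n) (xi W n) u).
Proof.
rewrite /upsilon /= -(poly_end_intertwine _ _ (@mc_d_xi n)); congr (_ + _).
case: n u => [|n] u //=.
rewrite (poly_end_intertwine _ _ (@mc_b_xi n)).
by rewrite (poly_end_intertwine _ _ (@mc_d_xi n)).
Qed.

End MixedComplexTheory.

Theorem proposition1 (R : nzRingType) (W : mixed_complex R)
    (c : nat -> {poly center R}) (c_m1 : {poly center R}) (n : nat) :
  let cn := c n in
  let cp := pred_seq c_m1 c n in
  let fn := cn - cp in
  let xin := xi W n in
  let upsn := upsilon W c n in
  [/\ upsn =1 (xin \o poly_end cn xin)
              \- (lower (mc_d W) n \o poly_end fn xin),
      upsn =1 (mc_b W n \o mc_d W n \o poly_end fn xin)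
              \+ (xin \o poly_end cp xin)
    & (upsn \- (xin \o poly_end cn xin)) \o (upsn \- (xin \o poly_end cp xin))
        =1 \0].
Proof.
move=> cn cp fn xin upsn.
have xiE u : xin u = mc_b W n (mc_d W n u) + lower (mc_d W) n u by [].
have ups_cn u : upsn u = xin (poly_end cn xin u)
                         - lower (mc_d W) n (poly_end fn xin u).
  rewrite /upsn (upsilonE _ c_m1) -/cn -/cp -/xin xiE poly_endB raddfB /=.
  by rewrite opprB [_ - _]addrC addrA addrK.
have ups_cp u : upsn u = mc_b W n (mc_d W n (poly_end fn xin u))
                         + xin (poly_end cp xin u).
  rewrite /upsn (upsilonE _ c_m1) -/cn -/cp -/xin xiE poly_endB !raddfB /=.
  by rewrite addrA subrK.
have ups_sub_cp u : upsn u - xin (poly_end cp xin u)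
                     = mc_b W n (mc_d W n (poly_end fn xin u)).
  by rewrite ups_cp addrK.
have ups_sub_cn u : upsn u - xin (poly_end cn xin u)
                    = - lower (mc_d W) n (poly_end fn xin u).
  by rewrite ups_cn addrAC subrr add0r.
split=> // u; rewrite -[LHS]/(upsn _ - xin (poly_end cn xin _)).
rewrite ups_sub_cn -[X in poly_end fn xin X]/(upsn u - xin (poly_end cp xin u)).
rewrite ups_sub_cp.
(* b moves to the left of f_n, next to e. *)
by rewrite -(poly_end_intertwine _ _ (@mc_b_xi _ W n)) lower_mc_b oppr0.
Qed.
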